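(* Let $Y$ be a nonempty compact Hausdorff space and let $0<\epsilon<1/4$. Suppose that $X$ is a finite (Hausdorff, hence discrete) space with at least two points, and let $T:C(X)\to C(Y)$ be an $\epsilon$-disjointness preserving operator with $\|T\|=1$. Then there exists a weighted composition map $S:C(X)\to C(Y)$ such that $\|T-S\|\le 2\sqrt{\epsilon}$.
   Context: $\mathbb{K}$ denotes $\mathbb{R}$ or $\mathbb{C}$. For a compact Hausdorff space $Z$, $C(Z)$ is the Banach space of $\mathbb{K}$-valued continuous functions on $Z$ with the sup norm $\|\cdot\|_\infty$; norms of operators are operator norms. For $\epsilon>0$, an operator $T:C(X)\to C(Y)$ is $\epsilon$-disjointness preserving if it is linear, continuous, and $\|(Tf)(Tg)\|_\infty\le\epsilon$ whenever $f,g\in C(X)$ satisfy $\|f\|_\infty=\|g\|_\infty=1$ and $fg\equiv 0$. An operator $S:C(X)\to C(Y)$ is a weighted composition map if there exist $a\in C(Y)$ and a map $h:Y\to X$, continuous on $c(a):=\{y\in Y:a(y)\ne 0\}$, such that $(Sf)(y)=a(y)f(h(y))$ for every $f\in C(X)$ and $y\in Y$ (the case $S\equiv 0$ is included). *)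

(* Defs.v *)
From HB Require Import structures.
From mathcomp Require Import all_boot all_order all_algebra.
From mathcomp Require Import complex.
From mathcomp Require Import all_classical all_reals topology normedtype.

Set Implicit Arguments.
Unset Strict Implicit.
Unset Printing Implicit Defensive.

Import Order.TTheory GRing.Theory Num.Theory.
Import numFieldNormedType.Exports.

Local Open Scope classical_set_scope.
Local Open Scope ring_scope.

Variant scalar_kind := RealScalars | ComplexScalars.

Definition scalars (R : realType) (k : scalar_kind) : numFieldType :=
  match k with RealScalars => R | ComplexScalars => R[i] end.

Definition of_real (R : realType) (k : scalar_kind) : R -> scalars R k :=
  match k with RealScalars => id | ComplexScalars => @real_complex R end.

Definition modulus (R : realType) (k : scalar_kind) : scalars R k -> R :=
  match k with
  | RealScalars => fun x => `|x|
  | ComplexScalars => @ComplexField.Normc.normc R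
  end.

Section Modulus.
Context {R : realType} {k : scalar_kind}.
Local Notation K := (scalars R k).
Implicit Types x y : K.

Lemma of_real_le (r s : R) : (of_real k r <= of_real k s) = (r <= s).
Proof. by case: k => //=; exact: lecR. Qed.

Lemma of_real_lt (r s : R) : (of_real k r < of_real k s) = (r < s).
Proof. by case: k => //=; exact: ltcR. Qed.

Lemma of_realD (r s : R) : of_real k (r + s) = of_real k r + of_real k s.
Proof. by case: k => //=; exact: rmorphD. Qed.

Lemma of_realM (r s : R) : of_real k (r * s) = of_real k r * of_real k s.
Proof. by case: k => //=; exact: rmorphM. Qed.

Lemma of_real0 : of_real k (0 : R) = 0.
Proof. by case: k => //=; exact: rmorph0. Qed.

Lemma of_real_inj : injective (@of_real R k).
Proof. by case: k => //=; exact: complexI. Qed.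

Lemma of_real_modulus x : of_real k (modulus x) = `|x|.
Proof. by move: x; case: k. Qed.

Lemma modulus_ge0 x : 0 <= modulus x.
Proof. by rewrite -of_real_le of_real_modulus of_real0. Qed.

Lemma modulusM x y : modulus (x * y) = modulus x * modulus y.
Proof. by apply: of_real_inj; rewrite of_realM !of_real_modulus normrM. Qed.

Lemma ler_modulusD x y : modulus (x + y) <= modulus x + modulus y.
Proof. by rewrite -of_real_le of_realD !of_real_modulus ler_normD. Qed.

Lemma modulusN x : modulus (- x) = modulus x.
Proof. by apply: of_real_inj; rewrite !of_real_modulus normrN. Qed.

Lemma modulus0 : modulus (0 : K) = 0.
Proof. by apply: of_real_inj; rewrite of_real_modulus normr0 of_real0. Qed.

Lemma modulus0_eq0 x : modulus x = 0 -> x = 0.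
Proof. by move=> x0; apply/normr0_eq0; rewrite -of_real_modulus x0 of_real0. Qed.

Lemma ler_dist_modulus x y : `|modulus x - modulus y| <= modulus (x - y).
Proof.
rewrite ler_norml; apply/andP; split.
  rewrite lerNl opprB lerBlDr -(modulusN (x - y)) opprB.
  by rewrite (le_trans _ (ler_modulusD _ _))// subrK.
by rewrite lerBlDr (le_trans _ (ler_modulusD _ _))// subrK.
Qed.

Lemma continuous_modulus : continuous (@modulus R k : K -> R).
Proof.
move=> x; apply/(@cvgrPdist_lt R R^o K (nbhs x)) => e e0.
have e0' : 0 < of_real k e by rewrite -of_real0 of_real_lt.
near=> y; apply: le_lt_trans (ler_dist_modulus _ _) _.
rewrite -of_real_lt of_real_modulus; near: y.
exact: (@nbhsx_ballx _ (K : normedModType K) x _ e0').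
Unshelve. all: by end_near.
Qed.

End Modulus.

HB.mixin Record isCompactHausdorff T & Topological T := {
  compact_setT : compact [set: T];
  hausdorff_setT : hausdorff_space T
}.

#[short(type="compactHausdorffType")]
HB.structure Definition CompactHausdorff :=
  {T of Topological T & isCompactHausdorff T}.

Definition sup_norm (R : realType) (k : scalar_kind) (Z : Type)
    (f : Z -> scalars R k) : R :=
  sup [set modulus (f z) | z in [set: Z]].

(* The library leaves the topology of [continuousType] open; this alias carries
   the topology of the sup norm. *)
Definition Cfun (R : realType) (k : scalar_kind) (Z : topologicalType) :=
  continuousType Z (scalars R k).

Section Cfun_lmodule.
Context {R : realType} {k : scalar_kind} {Z : topologicalType}.
Local Notation K := (scalars R k).
Local Notation C := (Cfun R k Z).
Implicit Types f g h : C.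

HB.instance Definition _ := Choice.copy C (continuousType Z K).

Lemma CfunP f g : f =1 g -> f = g.
Proof. by move=> fg; apply/continuousEP. Qed.

Let cts0 : continuous (cst 0 : Z -> K).
Proof. by move=> z; exact: cvg_cst. Qed.

Let ctsN f : continuous (\- (f : Z -> K)).
Proof. by move=> z; apply: cvgN; exact: cts_fun. Qed.

Let ctsD f g : continuous ((f : Z -> K) \+ g).
Proof. by move=> z; apply: cvgD; exact: cts_fun. Qed.

Let ctsZ (c : K) f : continuous (fun z => c * f z).
Proof. by move=> z; apply: cvgMl_tmp; exact: cts_fun. Qed.

Let zero : C := mkcts cts0.
Let opp f : C := mkcts (@ctsN f).
Let add f g : C := mkcts (@ctsD f g).
Let scale (c : K) f : C := mkcts (@ctsZ c f).

Let addA : associative add.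
Proof. by move=> f g h; apply: CfunP => z; exact: addrA. Qed.

Let addC : commutative add.
Proof. by move=> f g; apply: CfunP => z; exact: addrC. Qed.

Let add0 : left_id zero add.
Proof. by move=> f; apply: CfunP => z; exact: add0r. Qed.

Let addN : left_inverse zero opp add.
Proof. by move=> f; apply: CfunP => z; exact: addNr. Qed.

HB.instance Definition _ := GRing.isZmodule.Build C addA addC add0 addN.

Let scaleA (c d : K) f : scale c (scale d f) = scale (c * d) f.
Proof. by apply: CfunP => z; exact: mulrA. Qed.

Let scale1 : left_id 1 scale.
Proof. by move=> f; apply: CfunP => z; exact: mul1r. Qed.

Let scaleDr : right_distributive scale +%R.
Proof. by move=> c f g; apply: CfunP => z; exact: mulrDr. Qed.

Let scaleDl f : {morph scale^~ f : c d / c + d}.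
Proof. by move=> c d; apply: CfunP => z; exact: mulrDl. Qed.

HB.instance Definition _ :=
  GRing.Zmodule_isLmodule.Build K C scaleA scale1 scaleDr scaleDl.

Lemma Cfun0E (z : Z) : (0 : C) z = 0. Proof. by []. Qed.

Lemma CfunNE f z : (- f) z = - f z. Proof. by []. Qed.

Lemma CfunDE f g z : (f + g) z = f z + g z. Proof. by []. Qed.

Lemma CfunBE f g z : (f - g) z = f z - g z. Proof. by []. Qed.

Lemma CfunZE (c : K) f z : (c *: f) z = c * f z. Proof. by []. Qed.

End Cfun_lmodule.

Section Cfun_normed.
Context {R : realType} {k : scalar_kind} {Z : compactHausdorffType}.
Local Notation K := (scalars R k).
Local Notation C := (Cfun R k Z).
Implicit Types f g h : C.

Lemma has_ubound_modulus f : has_ubound [set modulus (f z) | z in [set: Z]].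
Proof.
have cf : compact [set modulus (f z) | z in [set: Z]].
  apply: (@continuous_compact _ _ (fun z => modulus (f z))).
    apply: continuous_subspaceT => z; apply: continuous_comp.
      exact: cts_fun.
    exact: continuous_modulus.
  exact: compact_setT.
have [M [_ HM]] := @compact_bounded R R^o _ cf.
exists (M + 1) => _ [z _ <-].
apply: le_trans (HM (M + 1) _ _ _); rewrite ?ltrDl//; last by exists z.
exact: ler_norm.
Qed.

Lemma ler_sup_norm f z : modulus (f z) <= sup_norm f.
Proof. by apply: ub_le_sup; [exact: has_ubound_modulus|exists z]. Qed.

Lemma sup_norm_ge0 f : 0 <= sup_norm f.
Proof.
have [Z0|/set0P[z _]] := eqVneq [set: Z] set0.
  by rewrite /sup_norm Z0 image_set0 sup0.
exact: le_trans (modulus_ge0 _) (ler_sup_norm f z).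
Qed.

Lemma sup_norm_le f (r : R) :
  0 <= r -> (forall z, modulus (f z) <= r) -> sup_norm f <= r.
Proof.
move=> r0 fr; have [Z0|/set0P[z _]] := eqVneq [set: Z] set0.
  by rewrite /sup_norm Z0 image_set0 sup0.
apply: ge_sup => [|_ [t _ <-]]; last exact: fr.
by exists (modulus (f z)), z.
Qed.

Let normD f g :
  of_real k (sup_norm (f + g)) <= of_real k (sup_norm f) + of_real k (sup_norm g).
Proof.
rewrite -of_realD of_real_le; apply: sup_norm_le => [|z].
  by rewrite addr_ge0// sup_norm_ge0.
by rewrite (le_trans (ler_modulusD _ _))// lerD// ler_sup_norm.
Qed.

Let normZ (c : K) f :
  of_real k (sup_norm (c *: f)) = `|c| * of_real k (sup_norm f).
Proof.
rewrite -of_real_modulus -of_realM; congr of_real; apply/eqP.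
rewrite eq_le; apply/andP; split.
  apply: sup_norm_le => [|z]; first by rewrite mulr_ge0 ?modulus_ge0 ?sup_norm_ge0.
  by rewrite CfunZE modulusM ler_wpM2l ?modulus_ge0 ?ler_sup_norm.
have [->|c0] := eqVneq c 0; first by rewrite modulus0 mul0r sup_norm_ge0.
have c1 : 0 < modulus c.
  rewrite lt_neqAle modulus_ge0 andbT eq_sym; apply: contra c0 => /eqP.
  by move=> /modulus0_eq0 ->.
rewrite mulrC -ler_pdivlMr//; apply: sup_norm_le => [|z].
  by rewrite divr_ge0 ?sup_norm_ge0// ltW.
by rewrite ler_pdivlMr// mulrC -modulusM -CfunZE ler_sup_norm.
Qed.

Let norm_eq0 f : of_real k (sup_norm f) = 0 -> f = 0.
Proof.
rewrite -of_real0 => /of_real_inj f0; apply: CfunP => z; apply: modulus0_eq0.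
by apply/eqP; rewrite eq_le modulus_ge0 andbT -f0 ler_sup_norm.
Qed.

(* A [normedModType] over K has a K-valued norm. *)
HB.instance Definition _ :=
  @Lmodule_isNormed.Build K C (fun f => of_real k (sup_norm f))
    normD normZ norm_eq0.

Lemma Cfun_normE f : `|f| = of_real k (sup_norm f).
Proof. by []. Qed.

End Cfun_normed.

Section Operators.
Context {R : realType} {k : scalar_kind} {X Y : compactHausdorffType}.
Local Notation CX := (Cfun R k X).
Local Notation CY := (Cfun R k Y).

(* Meaningful for bounded T: [sup] is 0 on sets without an upper bound. *)
Definition operator_norm (T : CX -> CY) : R :=
  sup [set sup_norm (T f) | f in [set f : CX | sup_norm f <= 1]].

Definition disjointness_preserving (eps : R) (T : {linear CX -> CY}) : Prop :=
  continuous T /\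
  forall f g : CX, sup_norm f = 1 -> sup_norm g = 1 ->
    (forall x, f x * g x = 0) ->
    sup_norm (fun y => T f y * T g y) <= eps.

Definition weighted_composition (S : {linear CX -> CY}) : Prop :=
  continuous S /\
  exists (a : CY) (h : Y -> X),
    {within [set y | a y != 0], continuous h} /\
    forall (f : CX) (y : Y), S f y = a y * f (h y).

End Operators.

(* Main.v *)
Require Import Defs.
From HB Require Import structures.
From mathcomp Require Import all_boot all_order all_algebra.
From mathcomp Require Import complex lra.
From mathcomp Require Import all_classical all_reals topology normedtype.

Set Implicit Arguments.
Unset Strict Implicit.
Unset Printing Implicit Defensive.

Import Order.TTheory GRing.Theory Num.Theory.
Import numFieldNormedType.Exports.

Local Open Scope classical_set_scope.
Local Open Scope ring_scope.

(* Write T f y = \sum_x f x * a_x y and let m y = \sum_x |a_x y|, d = sqrt eps.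
   Aligning phases, eps-disjointness preservation says that the masses p and q
   of complementary sets of coefficients at y satisfy p * q <= d ^ 2.  Where
   m y <= 2 d, take S = 0.  Where m y > 2 d, no partial mass equals d; fix an
   enumeration of X and let h y be the first point at which the partial mass
   exceeds d.  The points before h y and those after it have mass at most d
   each, so all of them together carry mass at most 2 d, and h is locally
   constant.  Shrinking a_(h y) y to modulus m y - 2 d keeps the error at most
   2 d and makes the weight vanish continuously where m y decreases to 2 d. *)

(** * Scalars: moduli, phases and convergence with real tolerances *)

Section Scalars.
Context {R : realType} {k : scalar_kind}.
Local Notation K := (scalars R k).

Lemma modulus_of_real (r : R) : modulus (of_real k r) = `|r|.
Proof.
by case: k => //=; rewrite expr0n addr0 sqrtr_sqr.
Qed.

Lemma of_realB (r s : R) : of_real k (r - s) = of_real k r - of_real k s.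
Proof. by apply: (addIr (of_real k s)); rewrite -of_realD !subrK. Qed.

Lemma modulus_gt0 (x : K) : (0 < modulus x) = (x != 0).
Proof.
rewrite lt_neqAle modulus_ge0 andbT eq_sym; congr (~~ _).
by apply/eqP/eqP => [/modulus0_eq0|->] //; exact: modulus0.
Qed.

Lemma modulus1 : modulus (1 : K) = 1.
Proof.
by apply: (@of_real_inj R k); rewrite of_real_modulus normr1; case: k.
Qed.

Lemma modulus_unit_phase (x : K) :
  exists2 u : K, modulus u = 1 & u * x = of_real k (modulus x).
Proof.
have [->|x0] := eqVneq x 0.
  by exists 1; rewrite ?modulus1// modulus0 of_real0 mulr0.
exists (x^-1 * of_real k (modulus x)); last by rewrite mulrAC mulVf ?mul1r.
apply: (@of_real_inj R k); rewrite of_real_modulus normrM normfV.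
rewrite of_real_modulus normr_id mulVf ?normr_eq0//.
by case: k.
Qed.

Lemma ler_modulus_sum (I : Type) (r : seq I) (F : I -> K) :
  modulus (\sum_(i <- r) F i) <= \sum_(i <- r) modulus (F i).
Proof.
elim/big_rec2: _ => [|i u v _ vu]; first by rewrite modulus0.
by rewrite (le_trans (ler_modulusD _ _))// lerD2l.
Qed.

Lemma of_real_sum (I : Type) (r : seq I) (F : I -> R) :
  of_real k (\sum_(i <- r) F i) = \sum_(i <- r) of_real k (F i).
Proof. exact: (big_morph _ of_realD of_real0). Qed.

(** The norm of [K] is [K]-valued, but a positive [e : K] equals [of_real k (modulus e)], so real
    tolerances suffice. *)
Lemma scalars_cvg (T : Type) (F : set_system T) (FF : Filter F) (f : T -> K)
    (l : K) :
  (forall e : R, 0 < e -> \forall t \near F, modulus (l - f t) < e) ->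
  f @ F --> l.
Proof.
move=> fl; apply/(@cvgrPdist_lt K (K : normedModType K)) => e e0.
have := fl (modulus e); rewrite modulus_gt0 gt_eqF// => /(_ isT).
apply: filterS => t; rewrite -(of_real_lt (k := k)) !of_real_modulus.
by rewrite (ger0_norm (ltW e0)).
Qed.

Lemma continuous_of_real : continuous (@of_real R k : R -> K).
Proof.
move=> r; apply: scalars_cvg => e e0; near=> t.
rewrite -of_realB modulus_of_real; near: t.
exact: (@nbhsx_ballx _ (R^o : normedModType R) r _ e0).
Unshelve. all: by end_near. Qed.

End Scalars.

Lemma Cfun_sumE (R : realType) (k : scalar_kind) (Z : topologicalType)
    (I : Type) (r : seq I) (F : I -> Cfun R k Z) z :
  (\sum_(i <- r) F i) z = \sum_(i <- r) F i z.
Proof. exact: (big_morph (fun g : Cfun R k Z => g z)). Qed.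

(** * Continuous functions on a finite Hausdorff space *)

Section FiniteSpace.
Context {X : compactHausdorffType}.
Hypothesis X_finite : finite_set [set: X].

(** Finite sets are closed in a Hausdorff space, so the complement of any preimage is closed. *)
Lemma finite_hausdorff_continuous (Z : topologicalType) (f : X -> Z) :
  continuous f.
Proof.
apply/continuousP => B _; rewrite -[X in open X]setCK.
have /accessible_finite_set_closed X_closed : accessible_space X.
  exact/hausdorff_accessible/hausdorff_setT.
apply: closed_openC; apply: X_closed.
exact: sub_finite_set (@subsetT _ _) X_finite.
Qed.

Context {R : realType} {k : scalar_kind}.

Definition finite_Cfun (f : X -> scalars R k) : Cfun R k X :=
  mkcts (finite_hausdorff_continuous (f := f)).

Lemma finite_CfunE f z : finite_Cfun f z = f z. Proof. by []. Qed.

Definition point_mass (x : X) := finite_Cfun (fun z => (z == x)%:R).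

Lemma Cfun_point_mass (s : seq X) (f : Cfun R k X) :
  uniq s -> (forall x, x \in s) -> f = \sum_(x <- s) f x *: point_mass x.
Proof.
move=> s_uniq s_all; apply: CfunP => z.
rewrite Cfun_sumE.
rewrite (bigD1_seq z)//= big1 ?addr0 => [|x xz].
  by rewrite CfunZE finite_CfunE eqxx mulr1.
by rewrite CfunZE finite_CfunE eq_sym (negbTE xz) mulr0.
Qed.

End FiniteSpace.

Lemma lipschitz_linear_continuous (R : realType) (k : scalar_kind)
    (X Y : compactHausdorffType) (C : R)
    (S : {linear Cfun R k X -> Cfun R k Y}) :
  (forall f, sup_norm (S f) <= C * sup_norm f) -> continuous S.
Proof.
move=> SC; apply/bounded_linear_continuous/linear_boundedP.
exists (of_real k C); split=> [|r Cr f].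
  by rewrite realE -(@of_real0 R k) !of_real_le le_total.
rewrite !Cfun_normE (@le_trans _ _ (of_real k (C * sup_norm f)))//.
  by rewrite of_real_le.
rewrite of_realM ler_wpM2r//; last exact: ltW.
by rewrite -(@of_real0 R k) of_real_le sup_norm_ge0.
Qed.

(** * The heavy point and the weighted composition map built from it *)

Section HeavyPoint.
Context {R : realType} {k : scalar_kind} {X Y : compactHausdorffType}.
Local Notation K := (scalars R k).
Context (x0 : X) (s : seq X) (a : X -> Cfun R k Y) (delta : R).

Definition mass (r : seq X) (y : Y) : R := \sum_(x <- r) modulus (a x y).

(** If no prefix passes the test, [find] returns [size s] and [heavy_point] falls back on [x0];
    inside [heavy_set] this cannot happen. *)
Definition heavy_index (y : Y) : nat :=
  find (fun n => delta < mass (take n.+1 s) y) (iota 0 (size s)).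

Definition heavy_point (y : Y) : X := nth x0 s (heavy_index y).

Definition heavy_set : set Y := [set y | 2 * delta < mass s y].

Hypothesis X_finite : finite_set [set: X].
Hypothesis delta_gt0 : 0 < delta.
Hypothesis split_mass :
  forall n y, mass (take n s) y * mass (drop n s) y <= delta ^+ 2.

Lemma mass_ge0 r y : 0 <= mass r y.
Proof. by apply: sumr_ge0 => x _; exact: modulus_ge0. Qed.

Lemma mass_split n y : mass s y = mass (take n s) y + mass (drop n s) y.
Proof. by rewrite /mass -big_cat cat_take_drop. Qed.

Lemma continuous_mass r : continuous (mass r : Y -> R).
Proof.
apply: (@continuous_big R^o) => [|x _]; first exact: add_continuous.
move=> y; apply: continuous_comp; first exact: cts_fun.
exact: continuous_modulus.
Qed.

Lemma heavy_index_lt y : heavy_set y -> (heavy_index y < size s)%N.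
Proof.
rewrite /heavy_set /= => sy; rewrite -[X in (_ < X)%N](size_iota 0) -has_find.
have s_gt0 : (0 < size s)%N.
  move: sy; rewrite /mass; case: s => //.
  by rewrite big_nil ltNge mulr_ge0// ltW.
(* The last index tests the whole of [s], whose mass exceeds [2 * delta]. *)
apply/hasP; exists (size s).-1; first by rewrite mem_iota add0n ltn_predL.
by rewrite prednK// take_size; move: delta_gt0 sy; lra.
Qed.

Lemma mass_take_heavy y :
  heavy_set y -> delta < mass (take (heavy_index y).+1 s) y.
Proof.
move=> sy; have ns := heavy_index_lt sy.
have := @nth_find _ 0%N (fun n => delta < mass (take n.+1 s) y)
  (iota 0 (size s)).
by rewrite has_find size_iota => /(_ ns); rewrite nth_iota.
Qed.

Lemma mass_take_before_heavy y :
  heavy_set y -> mass (take (heavy_index y) s) y <= delta.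
Proof.
move=> /heavy_index_lt ns; rewrite leNgt.
case E: (heavy_index y) ns => [|n] ns.
  by rewrite take0 /mass big_nil -leNgt ltW.
(* The prefix of length [n.+1] is the one tested at position [n], just before the first success. *)
have := @before_find _ 0%N (fun n => delta < mass (take n.+1 s) y)
  (iota 0 (size s)) n.
by rewrite -/(heavy_index y) E ltnSn nth_iota 1?ltnW// => /(_ isT) ->.
Qed.

Lemma heavy_point_mem y : heavy_set y -> heavy_point y \in s.
Proof. by move=> /heavy_index_lt; exact: mem_nth. Qed.

Lemma mass_heavy y :
  heavy_set y ->
  mass s y = modulus (a (heavy_point y) y) + mass (rem (heavy_point y) s) y.
Proof.
by move=> sy; rewrite /mass (big_rem (heavy_point y)) ?heavy_point_mem.
Qed.

(** The prefix through the heavy point has mass above [delta], so [split_mass] leaves at most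
    [delta] to the suffix; the earlier points carry at most [delta] by minimality of the index. *)
Lemma mass_rem_heavy y :
  heavy_set y -> mass (rem (heavy_point y) s) y <= 2 * delta.
Proof.
move=> sy; have ns := heavy_index_lt sy.
have m1 := mass_take_heavy sy; have m0 := mass_take_before_heavy sy.
have := split_mass (heavy_index y).+1 y.
set d := mass (drop _ s) y => md.
have dle : d <= delta.
  by have := mass_ge0 (drop (heavy_index y).+1 s) y; move: delta_gt0; nra.
(* The total mass is written in two ways; cancelling the heavy term gives the mass of [rem] without
   describing that list. *)
have := mass_heavy sy.
rewrite (mass_split (heavy_index y)) (drop_nth x0)// [X in _ + X]big_cons.
by rewrite -[X in _ + (_ + X)]/d -/(heavy_point y); lra.
Qed.

Lemma near_heavy y : heavy_set y -> \forall z \near y, heavy_set z.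
Proof. by move=> sy; exact: (cvgr_gt _ (@continuous_mass s y)). Qed.

(* If one part of the mass were equal to delta, the other would exceed delta and
   their product would exceed delta ^ 2. *)
Lemma near_heavy_point y :
  heavy_set y -> \forall z \near y, heavy_point z = heavy_point y.
Proof.
move=> sy.
(* The index depends only on these finitely many truth values, so it suffices that each is stable
   near [y]. *)
have : \forall z \near y, forall n : 'I_(size s),
    (delta < mass (take n.+1 s) z) = (delta < mass (take n.+1 s) y).
  apply: filter_forall => n; have cm := @continuous_mass (take n.+1 s) y.
  have [dm|md] := ltP delta (mass (take n.+1 s) y).
    by near=> z; near: z; exact: (cvgr_gt _ cm).
  have {}md : mass (take n.+1 s) y < delta.
    rewrite lt_neqAle md andbT; apply/eqP => mE.
    have := split_mass n.+1 y; move: sy; rewrite /heavy_set/= (mass_split n.+1).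
    by move: delta_gt0; rewrite mE; nra.
  near=> z; apply/negbTE; rewrite -leNgt ltW//.
  by near: z; exact: (cvgr_lt _ cm).
apply: filterS => z yz; rewrite /heavy_point; congr nth.
apply: eq_in_find => n; rewrite mem_iota add0n => /= ns.
exact: (yz (Ordinal ns)).
Unshelve. all: by end_near. Qed.

Definition heavy_weight (y : Y) : K :=
  of_real k ((mass s y - 2 * delta) / modulus (a (heavy_point y) y)) *
  a (heavy_point y) y.

(** The test matters: where the mass is below [2 * delta], the formula for [heavy_weight] need not
    vanish. *)
Definition heavy_composition (f : X -> K) (y : Y) : K :=
  if 2 * delta < mass s y then heavy_weight y * f (heavy_point y) else 0.

(** The total mass exceeds [2 * delta], while the points other than the heavy one carry at most
    that. *)
Lemma modulus_heavy_gt0 y :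
  heavy_set y -> 0 < modulus (a (heavy_point y) y).
Proof.
by move=> sy; have := mass_rem_heavy sy; have := mass_heavy sy; move: sy;
  move: delta_gt0; rewrite /heavy_set/=; lra.
Qed.

Lemma modulus_heavy_weight y :
  heavy_set y -> modulus (heavy_weight y) = mass s y - 2 * delta.
Proof.
move=> sy; have a0 := modulus_heavy_gt0 sy.
rewrite modulusM modulus_of_real ger0_norm; first by rewrite divfK ?gt_eqF.
by rewrite divr_ge0 ?modulus_ge0 ?subr_ge0 ?ltW.
Qed.

Lemma continuous_heavy_composition (f : Cfun R k X) :
  continuous (heavy_composition f : Y -> K).
Proof.
move=> y; have [sy|ys] := ltP (2 * delta) (mass s y).
  (* Near [y] the heavy point is constantly [x], so the function agrees there with a formula in
     which [x] is fixed. *)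
  pose x := heavy_point y.
  have : (fun z => of_real k ((mass s z - 2 * delta) / modulus (a x z)) *
      a x z * f x) @ y --> heavy_composition f y.
    rewrite /heavy_composition sy.
    apply: cvgMr_tmp; apply: cvgM; last exact: cts_fun.
    apply: (@continuous_comp _ _ _
      (fun z => (mass s z - 2 * delta) / modulus (a x z))).
      apply: (@cvgM R).
        by apply: (@cvgB R R^o); [exact: continuous_mass|exact: cvg_cst].
      apply: (@cvgV R); first by rewrite gt_eqF// modulus_heavy_gt0.
      by apply: continuous_comp; [exact: cts_fun|exact: continuous_modulus].
    exact: continuous_of_real.
  apply: cvg_trans; apply: near_eq_cvg; near=> z.
  rewrite /heavy_composition (_ : 2 * delta < mass s z); last first.
    by near: z; exact: near_heavy.
  rewrite /heavy_weight (_ : heavy_point z = x)//.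
  by near: z; exact: near_heavy_point.
apply: scalars_cvg => e e0; rewrite /heavy_composition ltNge ys /=.
have f0 := sup_norm_ge0 f.
(* Nearby nonzero weights have modulus [mass s z - 2 * delta], which is made small against the bound
   on [f]; the added 1 keeps the divisor positive when [f] is zero. *)
have e'0 : 0 < e / (sup_norm f + 1) by rewrite divr_gt0// ltr_wpDl.
near=> z; rewrite sub0r modulusN.
case: ifPn => [sz|_]; last by rewrite modulus0.
rewrite modulusM modulus_heavy_weight//.
have : mass s z - 2 * delta < e / (sup_norm f + 1).
  rewrite ltrBlDr; near: z; apply: (cvgr_lt _ (@continuous_mass s y)).
  by move: (mass s y) ys => m ?; lra.
rewrite ltr_pdivlMr; last by rewrite ltr_wpDl.
have := ler_sup_norm f (heavy_point z); have := modulus_ge0 (f (heavy_point z)).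
by nra.
Unshelve. all: by end_near. Qed.

Definition heavy_operator (f : Cfun R k X) : Cfun R k Y :=
  mkcts (@continuous_heavy_composition f).

Lemma heavy_operatorE f y : heavy_operator f y = heavy_composition f y.
Proof. by []. Qed.

Lemma heavy_operator_linear : linear heavy_operator.
Proof.
move=> c f g; apply: CfunP => y.
rewrite CfunDE CfunZE !heavy_operatorE /heavy_composition.
case: ifPn => _; last by rewrite mulr0 addr0.
by rewrite CfunDE CfunZE mulrDr mulrCA.
Qed.

HB.instance Definition _ :=
  GRing.isLinear.Build K (Cfun R k X) (Cfun R k Y) _ heavy_operator
    heavy_operator_linear.

Lemma heavy_operator_weighted_composition :
  weighted_composition heavy_operator.
Proof.
(* The image of the constant 1 is the weight, already bundled as a continuous function. *)
pose A := heavy_operator (finite_Cfun X_finite (cst 1)).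
have AE f y : heavy_operator f y = A y * f (heavy_point y).
  rewrite !heavy_operatorE /heavy_composition finite_CfunE mulr1.
  by case: ifP => _; rewrite ?mul0r.
split.
  apply: (@lipschitz_linear_continuous _ _ _ _ (sup_norm A)) => f.
  apply: sup_norm_le => [|y]; first by rewrite mulr_ge0 ?sup_norm_ge0.
  by rewrite AE modulusM ler_pM ?modulus_ge0 ?ler_sup_norm.
exists A, heavy_point; split=> //.
apply: continuous_in_subspaceT => y; rewrite inE /= => Ay.
(* A nonzero weight forces [y] into [heavy_set], where [heavy_point] is locally constant. *)
have sy : heavy_set y.
  move: Ay; rewrite heavy_operatorE /heavy_composition.
  by case: ifP; rewrite ?eqxx.
have : cst (heavy_point y) z @[z --> y] --> heavy_point y by exact: cvg_cst.
apply: cvg_trans; apply: near_eq_cvg.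
by near=> z; apply/esym; near: z; exact: near_heavy_point.
Unshelve. all: by end_near. Qed.

End HeavyPoint.

Lemma operator_norm_le (R : realType) (k : scalar_kind)
    (X Y : compactHausdorffType) (U : Cfun R k X -> Cfun R k Y) (r : R) :
  0 <= r ->
  (forall (f : Cfun R k X) y, sup_norm f <= 1 -> modulus (U f y) <= r) ->
  operator_norm U <= r.
Proof.
move=> r0 Ur; apply: ge_sup => [|_ [f f1 <-]].
  (* Bounding a supremum by [ge_sup] needs a nonempty set; the zero function provides an element. *)
  exists (sup_norm (U 0)), 0 => //=.
  by apply: sup_norm_le => [|x]; rewrite ?ler01// modulus0 ler01.
by apply: sup_norm_le => // y; exact: Ur.
Qed.

(** * Coefficients of [T] and the distance to the constructed map *)

Section Operator.
Context {R : realType} {k : scalar_kind} {X Y : compactHausdorffType}.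
Hypothesis X_finite : finite_set [set: X].
Context (s : seq X) (s_uniq : uniq s) (s_all : forall x, x \in s).
Context (T : {linear Cfun R k X -> Cfun R k Y}).

Definition coefficient (x : X) : Cfun R k Y := T (point_mass X_finite x).

Lemma linear_coefficientE f y :
  T f y = \sum_(x <- s) f x * coefficient x y.
Proof.
rewrite [in LHS](Cfun_point_mass X_finite f s_uniq s_all) linear_sum Cfun_sumE.
by apply: eq_bigr => x _; rewrite linearZ CfunZE.
Qed.

(** On [r] the function takes unit scalars that undo the phases of the coefficients at [y], so the
    terms add without cancellation; a nonempty [r] makes its norm exactly 1. *)
Lemma exists_aligned (r : seq X) y :
  r != [::] -> uniq r ->
  exists f : Cfun R k X, [/\ sup_norm f = 1, forall x, x \notin r -> f x = 0
    & T f y = of_real k (mass coefficient r y)].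
Proof.
move=> r0 r_uniq.
have : forall x, exists u : scalars R k,
    modulus u = 1 /\
    u * coefficient x y = of_real k (modulus (coefficient x y)).
  by move=> x; have [u] := modulus_unit_phase (coefficient x y); exists u.
move=> /choice[u uP].
pose f := finite_Cfun X_finite (fun x => if x \in r then u x else 0).
have fE x : x \in r -> f x = u x by rewrite finite_CfunE => ->.
have f0 x : x \notin r -> f x = 0 by rewrite finite_CfunE => /negbTE ->.
exists f; split=> //.
  apply/eqP; rewrite eq_le; apply/andP; split.
    apply: sup_norm_le => // x; have [xr|xr] := boolP (x \in r).
      by rewrite fE// (uP x).1.
    by rewrite f0// modulus0.
  have [x xr] : exists x, x \in r.
    by move: r0; case: (r) => // x r' _; exists x; exact: mem_head.
  by rewrite -(uP x).1 -fE// ler_sup_norm.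
rewrite linear_coefficientE /mass of_real_sum.
have rs : perm_eq [seq x <- s | x \in r] r.
  apply: uniq_perm => [||x]; rewrite ?filter_uniq// mem_filter.
  by rewrite s_all andbT.
rewrite -(perm_big _ rs) big_filter [RHS]big_mkcond.
apply: eq_bigr => x _; have [xr|xr] := boolP (x \in r).
  by rewrite fE// (uP x).2.
by rewrite f0// mul0r.
Qed.

(** Functions aligned on disjoint lists have product zero, and their images at [y] are the two
    masses. *)
Lemma disjointness_preserving_mass (eps : R) (r1 r2 : seq X) y :
  0 < eps -> disjointness_preserving eps T ->
  uniq r1 -> uniq r2 -> ~~ has [in r1] r2 ->
  mass coefficient r1 y * mass coefficient r2 y <= eps.
Proof.
move=> eps0 [_ T_disj] r1_uniq r2_uniq r12.
(* An empty list supports no function of norm 1, but its mass is 0. *)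
have [->|r1_neq0] := eqVneq r1 [::]; first by rewrite /mass big_nil mul0r ltW.
have [->|r2_neq0] := eqVneq r2 [::]; first by rewrite /mass big_nil mulr0 ltW.
have [f [f1 f0 fE]] := exists_aligned y r1_neq0 r1_uniq.
have [g [g1 g0 gE]] := exists_aligned y r2_neq0 r2_uniq.
have fg x : f x * g x = 0.
  have [xr1|xr1] := boolP (x \in r1); last by rewrite f0// mul0r.
  rewrite g0 ?mulr0//; apply: contra r12 => xr2.
  by apply/hasP; exists x.
(* [ler_sup_norm] speaks of bundled continuous functions, so the product has to be bundled. *)
have TfTg : continuous (fun z => T f z * T g z).
  by move=> z; apply: cvgM; exact: cts_fun.
apply: le_trans (T_disj f g f1 g1 fg).
have := ler_sup_norm (mkcts TfTg : Cfun R k Y) y.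
rewrite /mkcts modulusM fE gE !modulus_of_real.
by rewrite !ger0_norm ?mass_ge0.
Qed.

(** On [heavy_set], the points other than the heavy one contribute at most their mass [q], and
    shrinking the heavy coefficient costs at most [2 * delta - q]. Elsewhere the total mass bounds
    the error. *)
Lemma heavy_operator_dist (x0 : X) (delta : R) (delta_gt0 : 0 < delta)
    (split_mass : forall n y,
      mass coefficient (take n s) y * mass coefficient (drop n s) y
        <= delta ^+ 2)
    (f : Cfun R k X) (y : Y) :
  sup_norm f <= 1 ->
  modulus ((T \- heavy_operator x0 delta_gt0 split_mass) f y) <= 2 * delta.
Proof.
move=> f1.
have fle x : modulus (f x) <= 1 by exact: le_trans (ler_sup_norm f x) f1.
have sum_le r :
    modulus (\sum_(x <- r) f x * coefficient x y) <= mass coefficient r y.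
  apply: le_trans (ler_modulus_sum _ _) _; apply: ler_sum => x _.
  by rewrite modulusM ler_piMl ?modulus_ge0.
rewrite /= CfunBE heavy_operatorE /heavy_composition linear_coefficientE.
case: ifPn => [sy|]; last by rewrite -leNgt subr0; exact: le_trans.
set h := heavy_point _ _ _ _ y.
have hs : h \in s by exact: s_all.
have h0 := modulus_heavy_gt0 x0 delta_gt0 split_mass sy.
have mE := mass_heavy x0 delta_gt0 sy.
have mr := mass_rem_heavy x0 delta_gt0 split_mass sy.
rewrite -/h in h0 mE mr.
rewrite (big_rem h)//= addrAC.
apply: le_trans (ler_modulusD _ _) _.
have := sum_le (rem h s).
suff : modulus (f h * coefficient h y -
      heavy_weight x0 s coefficient delta y * f h) <=
    modulus (coefficient h y) - (mass coefficient s y - 2 * delta).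
  by rewrite mE; lra.
(* The shrinking factor [t] is at most 1 because the remaining mass is at most [2 * delta]. *)
set t := (mass coefficient s y - 2 * delta) / modulus (coefficient h y).
rewrite (_ : _ - _ = f h * (of_real k (1 - t) * coefficient h y)).
  rewrite modulusM (le_trans (ler_piMl _ (fle h))) ?modulus_ge0//.
  rewrite modulusM modulus_of_real ger0_norm.
    by rewrite mulrBl mul1r /t divfK ?gt_eqF.
  by rewrite subr_ge0 /t ler_pdivrMr// mul1r mE; lra.
rewrite of_realB mulrBl mulrBr; congr (_ - _).
  by congr (_ * _); rewrite -[LHS]mul1r; congr (_ * _); case: (k).
by rewrite mulrC.
Qed.

End Operator.

Theorem theorem4p3 (R : realType) (k : scalar_kind)
    (X Y : compactHausdorffType)
    (X_finite : finite_set [set: X])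
    (X_two_points : exists x1 x2 : X, x1 != x2)
    (Y_nonempty : [set: Y] !=set0)
    (eps : R) (eps_gt0 : 0 < eps) (eps_lt : eps < 1 / 4)
    (T : {linear Cfun R k X -> Cfun R k Y})
    (T_disj : disjointness_preserving eps T)
    (T_norm : operator_norm T = 1) :
  exists S : {linear Cfun R k X -> Cfun R k Y},
    weighted_composition S /\
    operator_norm (T \- S) <= 2 * Num.sqrt eps.
Proof.
have [x0 _] := X_two_points.
have [s [s_uniq s_all]] : exists s : seq X, uniq s /\ forall x, x \in s.
  have /finite_seqP[r rE] := X_finite.
  exists (undup r); split=> [|x]; first exact: undup_uniq.
  by rewrite mem_undup; have : [set: X] x by []; rewrite rE.
have delta_gt0 : 0 < Num.sqrt eps by rewrite sqrtr_gt0.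
have split_mass n y : mass (coefficient X_finite T) (take n s) y *
    mass (coefficient X_finite T) (drop n s) y <= Num.sqrt eps ^+ 2.
  rewrite sqr_sqrtr ?(ltW eps_gt0)//.
  apply: (disjointness_preserving_mass _ s_uniq s_all) => //.
  - exact: take_uniq.
  - exact: drop_uniq.
  (* As [s] has no repetition, a prefix and the matching suffix are disjoint. *)
  - by move: s_uniq; rewrite -{1}(cat_take_drop n s) cat_uniq => /and3P[].
exists (heavy_operator x0 delta_gt0 split_mass); split.
  exact: heavy_operator_weighted_composition.
apply: operator_norm_le => [|f y f1]; first by rewrite mulr_ge0 ?sqrtr_ge0.
exact: heavy_operator_dist.
Qed.
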